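(* Let $\mathbb{C}$ be an initial configuration on $S$ stacks, and form a virtual layer $V$ by picking one block from each of the $S$ stacks. Suppose that (1) there exists a block piled below the virtual layer (i.e. below the picked block of its stack) whose priority is higher than the highest priority of the blocks in $V$; and (2) the highest priority of the BP blocks in $V$ is lower than the lowest priority of all $S$ stacks after removing the blocks above the virtual layer. Then in every feasible move sequence for $\mathbb{C}$, at least one non-BG move is implemented on the blocks of $V$.
   Context: Setting (block relocation problem). There are $S$ stacks and $B$ blocks labelled by $\mathbb{B}=\{1,\dots,B\}$; a smaller label means a higher priority (earlier retrieval). A configuration places blocks in the stacks, each stack being a finite vertical sequence of blocks; the initial configuration $\mathbb{C}$ contains every block exactly once. A stack height limit $H$ may be imposed (each stack holds at most $H$ blocks; $H=\infty$ if there is no limit). A relocation takes the topmost block of a stack and puts it on top of a different stack (respecting the height limit). A retrieval removes from the bay the block of smallest label among those still present, and is allowed only if that block is topmost in its stack. A feasible move sequence is a finite sequence of relocations and retrievals starting from $\mathbb{C}$ after which all blocks have been retrieved. It is assumed that no block is directly retrievable in $\mathbb{C}$ (i.e. block $1$ is not topmost). In a given configuration, a block is badly placed (BP) if some block below it in the same stack has higher priority (smaller label); otherwise it is well placed (WP). A relocation is a BB, BG, GB or GG move, where the first letter is B (resp. G) if the moved block is BP (resp. WP) just before the move, and the second letter is B (resp. G) if it is BP (resp. WP) just after the move. A non-BG move is a BB, GB or GG move. The priority of a stack is the highest priority (smallest label) of a block in it, and $+\infty$ (the lowest priority) if it is empty. In the statement, BP and positions refer to $\mathbb{C}$; ''after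 removing the blocks above the virtual layer'' means that in each stack only the picked block and the blocks below it are kept. *)

(* Defs.v *)
From mathcomp Require Import all_boot.

Set Implicit Arguments.
Unset Strict Implicit.
Unset Printing Implicit Defensive.

(* A block is its label in {1, ..., B}.  A stack lists its blocks from top to
   bottom: the head of the sequence is the topmost block. *)
Definition config (S : nat) := {ffun 'I_S -> seq nat}.

Definition bay S (c : config S) : seq nat := flatten (codom c).

(* [None] stands for H = +oo. *)
Definition within (H : option nat) (h : nat) : bool :=
  if H is Some H' then h <= H' else true.

Definition initial_config S (B : nat) (H : option nat) (c : config S) : Prop :=
  perm_eq (bay c) (iota 1 B) /\ forall s, within H (size (c s)).

Definition topmost S (c : config S) (b : nat) : Prop :=
  exists s, ohead (c s) = Some b.

Definition below (b : nat) (st : seq nat) : seq nat := drop (index b st).+1 st.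

Definition keep_upto (b : nat) (st : seq nat) : seq nat := drop (index b st) st.

Definition BP S (c : config S) (b : nat) : bool :=
  [exists s, (b \in c s) && has (fun x => x < b) (below b (c s))].

Inductive move S :=
  | Relocate of nat & 'I_S & 'I_S
  | Retrieve of nat & 'I_S.

Definition set_stack S (c : config S) (s : 'I_S) (st : seq nat) : config S :=
  [ffun u => if u == s then st else c u].

Inductive step S (H : option nat) (c : config S) : move S -> config S -> Prop :=
  | StepRelocate b s t r of s != t & c s = b :: r & within H (size (c t)).+1 :
      step H c (Relocate b s t) (set_stack (set_stack c s r) t (b :: c t))
  | StepRetrieve b s r of c s = b :: r & all (leq b) (bay c) :
      step H c (Retrieve b s) (set_stack c s r).

Inductive run S (H : option nat) : config S -> seq (move S) -> config S -> Prop :=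
  | RunNil c : run H c [::] c
  | RunCons c m c' ms c'' of step H c m c' & run H c' ms c'' :
      run H c (m :: ms) c''.

Definition feasible S (H : option nat) (c : config S) (ms : seq (move S)) : Prop :=
  run H c ms [ffun=> [::]].

Inductive kind := BB | BG | GB | GG.

Definition kind_of S (c c' : config S) (b : nat) : kind :=
  match BP c b, BP c' b with
  | true, true => BB
  | true, false => BG
  | false, true => GB
  | false, false => GG
  end.

Definition has_nonBG_on S (H : option nat) (c : config S) (ms : seq (move S))
    (A : seq nat) : Prop :=
  exists ms1 b s t ms2 c1 c2,
    [/\ ms = ms1 ++ Relocate b s t :: ms2,
        run H c ms1 c1,
        step H c1 (Relocate b s t) c2,
        b \in A
      & kind_of c1 c2 b <> BG].

(* Priorities are labels, or [None] for +oo, the lowest priority; a smaller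
   value is a higher priority. *)
Definition higher (p q : option nat) : bool :=
  match p, q with
  | Some x, Some y => x < y
  | Some _, None => true
  | None, _ => false
  end.

(* On a whole stack this is the priority of the stack. *)
Definition highest_prio (A : seq nat) : option nat :=
  foldr (fun x p => if higher (Some x) p then Some x else p) None A.

Definition lowest_prio (ps : seq (option nat)) : option nat :=
  foldr (fun p q => if higher p q then q else p) (Some 0) ps.

(* Main.v *)
Require Import Defs.
From mathcomp Require Import all_boot.

Set Implicit Arguments.
Unset Strict Implicit.
Unset Printing Implicit Defensive.

(* Until some block of V is moved, each stack still ends with its picked block
   and everything below it. The first move on V is not a retrieval, since the
   block given by condition (1) is still buried in the bay. So it relocates some
   v in V; if v is BP then v was already BP in the initial configuration, and by
   condition (2) every stack still holds a block of higher priority than v, so v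
   is BP after the move as well. *)

(** The fold is a minimum with [None] as +oo, and lying strictly under a minimum means lying
    strictly under every entry. *)
Lemma higher_highest_prio (A : seq nat) (x : nat) :
  higher (Some x) (highest_prio A) = all (fun y => x < y) A.
Proof.
elim: A => //= y A <-; case: (highest_prio A) => [z|] /=; last by rewrite andbT.
case: (ltnP y z) => /= [yz|zy].
  by case: (ltnP x y) => //= xy; rewrite (ltn_trans xy yz).
by case: (ltnP x z) => [xz|]; rewrite ?andbF // (leq_trans xz zy).
Qed.

Lemma highest_prio_mem (A : seq nat) (x : nat) :
  highest_prio A = Some x -> x \in A.
Proof.
elim: A => //= y A IH; case: ifP => _; first by case=> ->; rewrite mem_head.
by move=> /IH xA; rewrite inE xA orbT.
Qed.

Lemma highest_prio_exists (A : seq nat) :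
  A != [::] -> exists x, highest_prio A = Some x.
Proof.
case: A => //= y A _; case: (highest_prio A) => [z|] /=; last by exists y.
by case: ifP => _; [exists y | exists z].
Qed.

Lemma lowest_prio_higher (ps : seq (option nat)) (q : option nat) (x : nat) :
  higher (lowest_prio ps) q -> Some x \in ps -> higher (Some x) q.
Proof.
elim: ps => //= p ps IH; rewrite inE.
case pq: (higher p (lowest_prio ps)) => hq /orP[/eqP xp | xps].
- move: pq hq; rewrite -xp; case: (lowest_prio ps) {IH} => [z|] //=.
  by case: q => //= y; apply: ltn_trans.
- exact: IH.
- by move: hq; rewrite -xp.
(* The fold keeps [p] here, so the lowest priority in [ps] is at most [p] as a label and still beats
   [q]. *)
apply: IH xps; case: p pq hq => [y|//].
case: (lowest_prio ps) => [z|//] /= /negbT; rewrite -leqNgt => zy.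
by case: q => //= w; apply: leq_ltn_trans.
Qed.

(** Serves to express distinctness of the labels as [mult c x <= 1] for all [x], a bound that moves
    preserve. *)
Definition mult S (c : config S) (x : nat) : nat :=
  \sum_(s < S) count_mem x (c s).

(** Both sides carry an added count so that no truncated subtraction occurs. *)
Lemma mult_set_stack S (c : config S) (s : 'I_S) (st : seq nat) (x : nat) :
  mult (set_stack c s st) x + count_mem x (c s) = mult c x + count_mem x st.
Proof.
rewrite /mult (bigD1 s) //= [in RHS](bigD1 s) //= ffunE eqxx.
rewrite (eq_bigr (fun u => count_mem x (c u))); last first.
  by move=> u /negbTE us; rewrite ffunE us.
by rewrite addnAC [in RHS]addnAC [count_mem x st + _]addnC.
Qed.

Lemma mult_step S H (c c' : config S) (m : move S) (x : nat) :
  step H c m c' -> mult c' x <= mult c x.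
Proof.
case=> [b s t r st cs _ | b s r cs _].
  have := mult_set_stack (set_stack c s r) t (b :: c t) x.
  have := mult_set_stack c s r x.
  rewrite ffunE eq_sym (negbTE st) cs /=.
  set m2 := mult (set_stack _ t _) x; set m1 := mult _ x => e1 e2.
  rewrite -(leq_add2r (count_mem x (c t))) e2 addnA leq_add2r.
  by rewrite -(leq_add2r (count_mem x r)) -addnA e1.
have := mult_set_stack c s r x; rewrite cs /= => e.
by rewrite -(leq_add2r (count_mem x r)) -e leq_add2l leq_addl.
Qed.

Lemma mult_bay S (c : config S) (x : nat) : mult c x = count_mem x (bay c).
Proof.
by rewrite /mult /bay count_flatten -map_comp sumnE big_map big_enum.
Qed.

(** [BP] quantifies over stacks; with at most one copy of [b], only [s] can be the witness. *)
Lemma BP_top S (c : config S) (s : 'I_S) (b : nat) (r : seq nat) :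
  mult c b <= 1 -> c s = b :: r -> BP c b = has (fun y => y < b) r.
Proof.
move=> m1 cs; apply/idP/idP; last first.
  by move=> hr; apply/existsP; exists s; rewrite cs /below /= mem_head eqxx drop0.
case/existsP=> t /andP[bt]; have [-> | ts] := eqVneq t s.
  by rewrite cs /below /= eqxx drop0.
(* A copy of [b] in another stack [t] would make the sum at least 2. *)
move: m1; rewrite /mult (bigD1 s) //= cs /= eqxx (bigD1 t) //= addnACA.
by move: bt; rewrite -has_pred1 has_count; case: (count _ _).
Qed.

Lemma nonBG_cons S H (c c' : config S) (m : move S) (ms : seq (move S)) A :
  step H c m c' -> has_nonBG_on H c' ms A -> has_nonBG_on H c (m :: ms) A.
Proof.
move=> st [ms1 [b [s [t [ms2 [c1 [c2 [-> r1 st2 bA nBG]]]]]]]].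
exists (m :: ms1), b, s, t, ms2, c1, c2; split=> //.
exact: RunCons st r1.
Qed.

(** The first three hypotheses do not mention [c], so induction on the run only has to maintain the
    suffixes [V s :: W s] and the bound on [mult]. The third is condition (2) stated for pairs of
    stacks. *)
Lemma layer_nonBG S H (V : 'I_S -> nat) (W : 'I_S -> seq nat) (x : nat)
    (s0 : 'I_S) (c : config S) (ms : seq (move S)) :
    x \in W s0 -> (forall s, x < V s) ->
    (forall s t, has (fun y => y < V s) (W s) ->
       has (fun y => y < V s) (V t :: W t)) ->
    (forall s, exists p, c s = p ++ V s :: W s) ->
    (forall y, mult c y <= 1) ->
  feasible H c ms -> has_nonBG_on H c ms (codom V).
Proof.
move=> xW xV hW; rewrite /feasible; set e : config S := [ffun=> _].
move Ee: e => c'' + + runc; move: Ee; rewrite /e {e}.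
elim: runc => {c ms c''} [c <- cV _ | c m c' ms c'' st _ IH Ee cV c1].
  (* An empty run would end with an empty bay, but stack [s0] holds [V s0]. *)
  by have [p] := cV s0; rewrite ffunE; case: p.
have c1' y : mult c' y <= 1 by apply: leq_trans (c1 y); apply: mult_step st.
have {IH}IHc (cV' : forall s, exists p, c' s = p ++ V s :: W s) :
    has_nonBG_on H c (m :: ms) (codom V).
  exact: nonBG_cons st (IH Ee cV' c1').
case: st (st) c1' IHc => [b s t r st cs _ | b s r cs bmin] stp c1' IHc.
  (* If something lies above [V s], the moved block comes from there and every suffix survives. *)
  have [[|z p] Es] := cV s; last first.
    move: Es; rewrite cs => -[_ Er]; apply: IHc => u; rewrite !ffunE.
    have [-> | _] := eqVneq u t; first by have [q ->] := cV t; exists (b :: q).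
    by have [-> | _] := eqVneq u s; [exists p | exact: cV].
  have [Eb Er] : b = V s /\ r = W s by move: Es; rewrite cs => -[-> ->].
  exists [::], b, s, t, ms, c; eexists; split; [by []|exact: RunNil|exact: stp| |].
    by rewrite Eb codom_f.
  rewrite /kind_of (BP_top (c1 b) cs).
  rewrite (@BP_top _ _ t b (c t) (c1' b)); last by rewrite ffunE eqxx.
  (* A WP block gives GB or GG whatever the target; a BP one must be shown to stay BP on [t]. *)
  case hr: (has _ r); last by case: ifP.
  suff -> : has (fun y => y < b) (c t) by [].
  have [q ->] := cV t; rewrite has_cat Eb (hW s t) ?orbT //.
  by rewrite -Eb -Er.
have [[|z p] Es] := cV s; last first.
  move: Es; rewrite cs => -[_ Er]; apply: IHc => u; rewrite !ffunE.
  by have [-> | _] := eqVneq u s; [exists p | exact: cV].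
have Eb : b = V s by move: Es; rewrite cs => -[].
(* [x] is still buried in [s0] and is smaller than [V s], against the minimality of a retrieved
   label. *)
have /(allP bmin) : x \in bay c.
  apply/flattenP; exists (c s0); first exact: codom_f.
  by have [q ->] := cV s0; rewrite mem_cat inE xW !orbT.
by rewrite leqNgt Eb xV.
Qed.

Theorem theorem3 (S B : nat) (H : option nat) (C : config S) (V : 'I_S -> nat)
    (hC : initial_config B H C)
    (h1 : ~ topmost C 1)
    (hV : forall s, V s \in C s)
    (cond1 : exists (s : 'I_S) (b : nat), b \in below (V s) (C s) /\
       higher (Some b) (highest_prio (codom V)))
    (cond2 : higher
       (lowest_prio [seq highest_prio (keep_upto (V s) (C s)) | s <- enum 'I_S])
       (highest_prio [seq b <- codom V | BP C b])) :
  forall ms : seq (move S), feasible H C ms -> has_nonBG_on H C ms (codom V).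
Proof.
move=> ms; have [s0 [x [xW]]] := cond1.
rewrite higher_highest_prio => /allP xV.
have keepE s : keep_upto (V s) (C s) = V s :: below (V s) (C s).
  by rewrite /keep_upto (drop_nth 0) ?index_mem // nth_index.
apply: (@layer_nonBG _ _ V (fun s => below (V s) (C s)) x s0) => //.
- by move=> s; apply: xV; apply: codom_f.
(* [z], the priority of the kept part of stack [t], beats every BP block of the layer by condition
   (2), and [hs] makes [V s] such a block. *)
- move=> s t hs; have [z hz] : exists z, highest_prio (keep_upto (V t) (C t)) = Some z.
    by apply: highest_prio_exists; rewrite keepE.
  rewrite -keepE; apply/hasP; exists z; first exact: highest_prio_mem.
  have : higher (Some z) (highest_prio [seq b <- codom V | BP C b]).
    by apply: lowest_prio_higher cond2 _; apply/mapP; exists t; rewrite ?mem_enum.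
  rewrite higher_highest_prio => /allP; apply.
  by rewrite mem_filter codom_f andbT; apply/existsP; exists s; rewrite hV.
- move=> s; exists (take (index (V s) (C s)) (C s)).
  by rewrite -keepE cat_take_drop.
move=> y; rewrite mult_bay; case: hC => /permP -> _.
by rewrite count_uniq_mem ?iota_uniq // leq_b1.
Qed.
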